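(* Suppose that Assumptions A1, A2 and A3 listed in the context hold. Let $(\bar g,\bar f)\in X\times Y$ be exact data, i.e. the system $$L(\bar u,\bar q)=\bar g,\qquad C\bar u=\bar f \qquad (\ast)$$ admits a solution $(\bar u,\bar q)$, and let $\{(g_\alpha,f_\alpha)\}_{\alpha>0}\subset X\times Y$ be a family of data with $\Vert g_\alpha-\bar g\Vert_X^2+\Vert f_\alpha-\bar f\Vert_Y^2=o(\alpha)$ as $\alpha\to0$. Put $$J_\alpha(u,q)=\Vert L(u,q)-g_\alpha\Vert_X^2+\Vert Cu-f_\alpha\Vert_Y^2+\alpha\,\psi(q).$$ Let $\{\alpha_n\}_{n=1}^\infty\subset\mathbb{R}^+$ be a sequence converging to zero, and let $\{(u_{\alpha_n},q_{\alpha_n})\}_{n=1}^\infty$ be a corresponding sequence of minimizers of $J_{\alpha_n}$ over $X\times Z$. Then $\{(u_{\alpha_n},q_{\alpha_n})\}_{n=1}^\infty$ has a subsequence that converges weakly in $X\times Z$ to a minimum norm solution $(\hat u,\hat q)$ of the system $(\ast)$, i.e. $$L(\hat u,\hat q)=\bar g,\qquad C\hat u=\bar f,\qquad \psi(\hat q)\le\psi(\bar q)\ \text{ for all } (\bar u,\bar q) \text{ satisfying } (\ast).$$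
   Context: $X,Y,Z$ are Hilbert spaces; $u\in X$ is the state variable and $q\in Z$ the unknown coefficient(s). $L$ is a bilinear operator of $(u,q)$ (possibly unbounded, with $X$-values on the domain described below), and $C$ is an observation map from $X$ to $Y$ (possibly defined only on $dom(L)$). The regularization term is a functional $\psi:Z\to(-\infty,+\infty]$, not identically $+\infty$. For fixed $q$ write $L_q u:=L(u,q)$. The set $dom(L)$ is a linear subspace of $X$ of admissible states, which may encode a side constraint that does not appear explicitly in $J_\alpha$. Convention: $J_\alpha(u,q)=+\infty$ if $u\notin dom(L)$ or $\psi(q)=+\infty$; solutions $(\bar u,\bar q)$ of $(\ast)$ are understood with $\bar u\in dom(L)$ and $\psi(\bar q)<\infty$. Assumption A1. $\psi$ is strictly convex, weakly lower semicontinuous, and coercive, i.e. there is a constant $c>0$ with $\psi(q)\ge c\Vert q\Vert_Z^2$ for all $q\in Z$. Assumption A2. Given a constant $c_0$, one has $dom(L)\subset\{u\in X: L(u,q)\in X \text{ and } Cu\in Y \text{ for all } q\in Z \text{ with } \psi(q)\le c_0\}$, and for every $q$ in the level set $\{q\in Z:\psi(q)\le c_0\}$ the operator $L_q:dom(L)\to X$ is a closed linear operator. Moreover the $L_q$ are uniformly coercive: there is a constant $c_1>0$ such that $\Vert L(u,q)\Vert_X\ge c_1\Vert u\Vert_X$ for all $u\in dom(L)$ and all $q$ in this level set. Furthermore, for every $g\in X$ and every such $q$, the equation $L(u,q)=g$ has a unique solution $u\in dom(L)$. Assumption A3. $L$ and $C$ are weakly sequentially closed: if a sequence $\{(u_n,q_n)\}$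 (in the domain where $L$ and $C$ are defined) converges weakly in $X\times Z$ to $(u,q)$, then $(u,q)$ is in that domain, $L(u_n,q_n)$ converges weakly to $L(u,q)$ in $X$, and $Cu_n$ converges weakly to $Cu$ in $Y$. *)

(* Defs.v *)
From HB Require Import structures.
From mathcomp Require Import all_boot all_order all_algebra.
From mathcomp Require Import all_classical all_reals all_analysis.
Set Implicit Arguments.
Unset Strict Implicit.
Unset Printing Implicit Defensive.
Import Order.TTheory GRing.Theory Num.Theory.
Import numFieldNormedType.Exports.
Local Open Scope classical_set_scope.
Local Open Scope ring_scope.

(* Real Hilbert spaces. A complex one is covered through its underlying real
   space (inner product 'Re <x, y>), which has the same norm and the same weakly
   convergent sequences. *)
HB.mixin Record CompleteNormedModule_isHilbert (R : realType) V
    & CompleteNormedModule R V := {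
  inner : V -> V -> R ;
  innerC : forall x y : V, inner x y = inner y x ;
  inner_linearl : forall (a : R) (x y z : V),
    inner (a *: x + y) z = a * inner x z + inner y z ;
  inner_norm : forall x : V, inner x x = `|x| ^+ 2 }.

#[short(type="hilbertType")]
HB.structure Definition Hilbert (R : realType) :=
  {V of CompleteNormedModule R V & CompleteNormedModule_isHilbert R V}.

Section weak_convergence.
Variable R : realType.

(* Weak convergence with respect to an explicit inner product, so that it also
   applies to [X * Z], whose canonical norm in the library is the max norm. *)
Definition weak_cvg (H : Type) (dot : H -> H -> R) (x_ : nat -> H) (x : H) :
    Prop :=
  forall y : H, (fun n => dot (x_ n) y) @ \oo --> dot x y.

Definition inner_prod (X Z : hilbertType R) (p p' : X * Z) : R :=
  inner p.1 p'.1 + inner p.2 p'.2.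

End weak_convergence.

Section functional.
Variables (R : realType) (Z : hilbertType R) (psi : Z -> \bar R).

Definition proper_functional : Prop :=
  (forall q, psi q != -oo%E) /\ (exists q, psi q != +oo%E).

Definition strictly_convex : Prop :=
  forall (q1 q2 : Z) (t : R), q1 != q2 -> 0 < t < 1 ->
    (psi q1 < +oo)%E -> (psi q2 < +oo)%E ->
    (psi (t *: q1 + (1 - t) *: q2)%R < t%:E * psi q1 + (1 - t)%:E * psi q2)%E.

Definition weakly_lower_semicontinuous : Prop :=
  forall (q_ : nat -> Z) (q : Z), weak_cvg inner q_ q ->
    (psi q <= limn_einf (fun n => psi (q_ n)))%E.

Definition coercive_functional : Prop :=
  exists2 c : R, 0 < c & forall q : Z, ((c * `|q| ^+ 2)%:E <= psi q)%E.

Definition assumption_A1 : Prop :=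
  [/\ strictly_convex, weakly_lower_semicontinuous & coercive_functional].

Definition level_set (c0 : R) : set Z := [set q | (psi q <= c0%:E)%E].

End functional.

Section operators.
Variables (R : realType) (X Y Z : hilbertType R).

Definition is_linear_subspace (D : set X) : Prop :=
  D 0 /\ forall (a : R) (u v : X), D u -> D v -> D (a *: u + v).

(* [D] is the set of the [(u, q)] at which the (unbounded) bilinear expression
   [L(u, q)] makes sense and belongs to [X]; the value of [L] elsewhere is
   meaningless. *)
Definition bilinear_on (D : set (X * Z)) (L : X -> Z -> X) : Prop :=
  (forall (a : R) (u v : X) (q : Z),
     D (u, q) -> D (v, q) -> D (a *: u + v, q) ->
     L (a *: u + v) q = a *: L u q + L v q) /\
  (forall (a : R) (u : X) (q r : Z),
     D (u, q) -> D (u, r) -> D (u, a *: q + r) ->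
     L u (a *: q + r) = a *: L u q + L u r).

Definition closed_linear_operator (D : set X) (T : X -> X) : Prop :=
  [/\ is_linear_subspace D,
      forall (a : R) (u v : X), D u -> D v -> T (a *: u + v) = a *: T u + T v
    & closed [set p : X * X | D p.1 /\ T p.1 = p.2]].

Variables (domL : set X) (DL : set (X * Z)) (L : X -> Z -> X).
Variables (DC : set X) (C : X -> Y).
Variable psi : Z -> \bar R.

Definition assumption_A2 (c0 : R) : Prop :=
  [/\ domL `<=` [set u | forall q, level_set psi c0 q -> DL (u, q) /\ DC u],
      forall q, level_set psi c0 q -> closed_linear_operator domL (L ^~ q),
      exists2 c1 : R, 0 < c1 &
        forall u q, domL u -> level_set psi c0 q -> c1 * `|u| <= `|L u q|
    & forall (g : X) (q : Z), level_set psi c0 q ->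
        exists! u, domL u /\ L u q = g].

Definition domLC : set (X * Z) :=
  [set p | [/\ domL p.1, DL p & DC p.1]].

Definition assumption_A3 : Prop :=
  forall (p_ : nat -> X * Z) (p : X * Z),
    (forall n, domLC (p_ n)) -> weak_cvg (@inner_prod R X Z) p_ p ->
    [/\ domLC p,
        weak_cvg inner (fun n => L (p_ n).1 (p_ n).2) (L p.1 p.2)
      & weak_cvg inner (fun n => C (p_ n).1) (C p.1)].

Definition solution (g : X) (f : Y) (u : X) (q : Z) : Prop :=
  [/\ domL u, (psi q < +oo)%E, L u q = g & C u = f].

Definition min_norm_solution (g : X) (f : Y) (u : X) (q : Z) : Prop :=
  solution g f u q /\
  forall (v : X) (r : Z), solution g f v r -> (psi q <= psi r)%E.

Definition tikhonov (alpha : R) (g : X) (f : Y) (u : X) (q : Z) : \bar R :=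
  if `[< domL u /\ (psi q < +oo)%E >] then
    ((`|L u q - g| ^+ 2 + `|C u - f| ^+ 2)%:E + alpha%:E * psi q)%E
  else +oo%E.

Definition minimizer (J : X -> Z -> \bar R) (u : X) (q : Z) : Prop :=
  forall (v : X) (r : Z), (J u q <= J v r)%E.

End operators.

(* Main.v *)
Require Import Defs.
From HB Require Import structures.
From mathcomp Require Import all_boot all_order all_algebra.
From mathcomp Require Import all_classical all_reals all_analysis.
From mathcomp Require Import ring lra.
Set Implicit Arguments.
Unset Strict Implicit.
Unset Printing Implicit Defensive.
Import Order.TTheory GRing.Theory Num.Theory.
Import numFieldNormedType.Exports.
Local Open Scope classical_set_scope.
Local Open Scope ring_scope.

(** The argument is the standard one for Tikhonov regularization. Let
[delta n] be the squared data error for the parameter [alpha n], so that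
[delta n / alpha n] tends to [0].
Comparing the value of the functional at the minimizer [(u n, q n)] with its
value at an exact solution [(v, r)] gives
[[
|L (u n) (q n) - g|^2 + |C (u n) - f|^2 + alpha n * psi (q n)
  <= delta n + alpha n * psi r
]]
([tikhonov_minimizer_le]). Three facts follow.

- Dividing by [alpha n], [psi (q n) <= delta n / alpha n + psi r]. Hence all the
  [q n] lie in one level set of [psi], and are bounded by coercivity of [psi].
- The misfit tends to [0], so [L (u n) (q n)] and [C (u n)] converge in norm to
  the exact data; the uniform coercivity of [L] on the level set then bounds
  [u n].
- Along any weakly convergent subsequence with limit [(uhat, qhat)], the weak
  closedness of [L] and [C] and the uniqueness of weak limits make it a
  solution, and weak lower semicontinuity turns the bound on [psi (q n)] into
  [psi qhat <= psi r], for every exact solution [(v, r)].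

What remains is the weak sequential compactness of bounded sequences in a
Hilbert space ([bounded_weak_subsequence]), without separability. A diagonal
extraction ([diagonal_subsequence], from Tychonoff's theorem) yields a
subsequence whose inner products with every [x_ m] converge. The vectors [y]
against which the subsequence converges form a closed subspace [V] that contains
all the [x_ m]. The limit is a bounded linear form on [V], represented by some
[p] in [V] ([riesz_closed_subspace]); and as the [x_ m] and [p] lie in [V], a
general [y] can be replaced by its orthogonal projection on [V], which the same
representation theorem provides. *)

(** * Inner products and weak limits *)

Section inner_product.
Variables (R : realType) (H : hilbertType R).
Implicit Types (x y z : H) (a : R).

Lemma innerDl x y z : inner (x + y) z = inner x z + inner y z.
Proof. by rewrite -[x]scale1r inner_linearl mul1r scale1r. Qed.

Lemma inner0l z : inner 0 z = 0.
Proof. by apply: (addrI (inner 0 z)); rewrite -innerDl !addr0. Qed.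

Lemma innerZl a x z : inner (a *: x) z = a * inner x z.
Proof. by rewrite -[a *: x]addr0 inner_linearl inner0l addr0. Qed.

Lemma innerBl x y z : inner (x - y) z = inner x z - inner y z.
Proof. by rewrite innerDl -scaleN1r innerZl mulN1r. Qed.

Lemma innerDr x y z : inner z (x + y) = inner z x + inner z y.
Proof. by rewrite innerC innerDl !(innerC _ z). Qed.

Lemma innerZr a x z : inner z (a *: x) = a * inner z x.
Proof. by rewrite innerC innerZl (innerC x). Qed.

Lemma innerBr x y z : inner z (x - y) = inner z x - inner z y.
Proof. by rewrite innerC innerBl !(innerC _ z). Qed.

Lemma sqr_normDZ x y a :
  `|x + a *: y| ^+ 2 = `|x| ^+ 2 + 2 * a * inner x y + a ^+ 2 * `|y| ^+ 2.
Proof.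
rewrite -!inner_norm innerDl !innerDr !innerZl !innerZr (innerC y x); ring.
Qed.

Lemma parallelogram x y :
  `|x + y| ^+ 2 + `|x - y| ^+ 2 = 2 * `|x| ^+ 2 + 2 * `|y| ^+ 2.
Proof.
rewrite -!inner_norm !innerBl !innerDl !innerBr !innerDr; lra.
Qed.

Lemma cauchy_schwarz x y : `|inner x y| <= `|x| * `|y|.
Proof.
have [->|y0] := eqVneq y 0.
  by rewrite innerC inner0l !normr0 mulr0.
have ny : 0 < `|y| by rewrite normr_gt0.
rewrite -ler_sqr ?nnegrE ?mulr_ge0// exprMn real_normK ?num_real//.
(* This combination is the component of [x] orthogonal to [y]. *)
have := sqr_ge0 `|x + (- (inner x y / `|y| ^+ 2)) *: y|.
rewrite sqr_normDZ.
have -> : `|x| ^+ 2 + 2 * (- (inner x y / `|y| ^+ 2)) * inner x y +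
    (- (inner x y / `|y| ^+ 2)) ^+ 2 * `|y| ^+ 2 =
    `|x| ^+ 2 - inner x y ^+ 2 / `|y| ^+ 2 by field; rewrite gt_eqF.
by rewrite subr_ge0 ler_pdivrMr// exprn_gt0.
Qed.

Lemma cvg_weak_cvg (x_ : nat -> H) x : x_ @ \oo --> x -> weak_cvg inner x_ x.
Proof.
move=> xx y; apply/cvgrPdist_le => e e0.
have y0 : 0 < `|y| + 1 by rewrite ltr_wpDl.
near=> n; rewrite -innerBl (le_trans (cauchy_schwarz _ _))//.
rewrite -(divfK (lt0r_neq0 y0) e).
rewrite ler_pM ?lerDl//; near: n.
by move/cvgrPdist_le : xx; apply; rewrite divr_gt0.
Unshelve. all: by end_near. Qed.

Lemma weak_cvg_unique (x_ : nat -> H) x y :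
  weak_cvg inner x_ x -> weak_cvg inner x_ y -> x = y.
Proof.
move=> xx xy; apply/eqP; rewrite -subr_eq0 -normr_eq0 -sqrf_eq0 -inner_norm.
rewrite innerBl subr_eq0; apply/eqP.
exact: cvg_unique (xx (x - y)) (xy (x - y)).
Qed.

End inner_product.

(** * Riesz representation on a closed subspace *)

Section riesz.
Variables (R : realType) (H : hilbertType R).
Implicit Types (V : set H) (phi : H -> R).

Lemma linear_subspaceZ V a v : is_linear_subspace V -> V v -> V (a *: v).
Proof. by move=> [V0 VL] Vv; rewrite -[_ *: _]addr0; exact: VL. Qed.

Lemma linear_subspaceD V v w : is_linear_subspace V -> V v -> V w -> V (v + w).
Proof. by move=> [V0 VL] Vv Vw; rewrite -[v]scale1r; exact: VL. Qed.

(** The representing vector minimizes the quadratic functional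
[F v = |v|^2 - 2 * phi v] over [V]: minimizing sequences are Cauchy by the
parallelogram identity, and the first variation of [F] vanishes at the minimum.
Working on a subspace makes the orthogonal projection of [y] on [V] the special
case [phi = inner y]. *)
Theorem riesz_closed_subspace V phi (M : R) :
  is_linear_subspace V -> closed V ->
  (forall a v w, V v -> V w -> phi (a *: v + w) = a * phi v + phi w) ->
  (forall v, V v -> `|phi v| <= M * `|v|) ->
  exists2 p, V p & forall v, V v -> inner p v = phi v.
Proof.
move=> VL Vcl phiL phiM; have V0 := VL.1.
have phi0 : phi 0 = 0.
  by have := phiL 1 _ _ V0 V0; rewrite scaler0 addr0; lra.
have phiZ a v : V v -> phi (a *: v) = a * phi v.
  by move=> Vv; rewrite -[_ *: _]addr0 phiL// phi0 addr0.
have phiD v w : V v -> V w -> phi (v + w) = phi v + phi w.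
  by move=> Vv Vw; rewrite -[v]scale1r phiL// mul1r scale1r.
pose F v := `|v| ^+ 2 - 2 * phi v.
have infF : has_inf (F @` V).
  split; first by exists (F 0), 0.
  exists (- M ^+ 2) => _ [v Vv <-]; rewrite /F.
  (* The bound comes from [(|v| - M)^2 >= 0]. *)
  have := phiM v Vv; rewrite ler_norml => /andP[_].
  have := sqr_ge0 (`|v| - M); rewrite sqrrB; lra.
pose m := inf (F @` V).
have Fm v : V v -> m <= F v by move=> Vv; apply: ge_inf infF.2 _ _; exists v.
have /choice[v_ v_min] n : exists v, V v /\ F v < m + harmonic n.
  have [_ [v Vv <-] vm] := @inf_adherent _ _ (harmonic n) (harmonic_gt0 _) infF.
  by exists v.
have Vv n : V (v_ n) := (v_min n).1.
(* By the parallelogram identity, [|v - w|^2 / 2] is the sum of the values of [F]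
   at [v] and [w] minus twice its value at their midpoint, which is at least
   [m]. *)
have dist_v n k : `|v_ n - v_ k| ^+ 2 <= 2 * harmonic n + 2 * harmonic k.
  have Fn := (v_min n).2; have Fk := (v_min k).2.
  have := Fm _ (linear_subspaceZ 2^-1 VL (linear_subspaceD VL (Vv n) (Vv k))).
  rewrite /F phiZ ?phiD//; last exact: linear_subspaceD.
  rewrite normrZ exprMn gtr0_norm ?invr_gt0//.
  move: Fn Fk; rewrite /F.
  have := parallelogram (v_ n) (v_ k); lra.
have : cvgn v_.
  apply: cauchy_cvg; apply: cauchy_exP => e e0.
  have : \forall N \near \oo, harmonic N < e ^+ 2 / 4 :> R.
    apply: (cvgr_lt (0 : R)); first exact: cvg_harmonic.
    by rewrite divr_gt0// exprn_gt0.
  move=> [N _ /(_ N (leqnn N)) Ne].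
  have {}Ne : harmonic N < e ^+ 2 / 4 :> R by [].
  exists (v_ N), N => // n /= Nn.
  rewrite -ball_normE/= -ltr_sqr ?nnegrE ?(ltW e0)//.
  rewrite (le_lt_trans (dist_v N n))//.
  have : harmonic n <= harmonic N :> R by rewrite lef_pV2 ?posrE// ler_nat.
  move: (harmonic n) (harmonic N) Ne => hn hN; lra.
move=> /cvg_ex[p v_p].
have Vp : V p by apply: (closed_cvg _ Vcl _ _ v_p); exact: nearW.
exists p => // w Vw.
(* The right-hand side is [F (p + t *: w) - F p]. Passing to the limit in the
   same difference at [v_ n] shows it nonnegative and uses only the continuity of
   the inner product, not that of [F]. *)
have var t : 0 <= 2 * t * (inner p w - phi w) + t ^+ 2 * `|w| ^+ 2.
  have cvgl : (fun n => 2 * t * (inner (v_ n) w - phi w) + t ^+ 2 * `|w| ^+ 2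
      + harmonic n) @ \oo -->
      2 * t * (inner p w - phi w) + t ^+ 2 * `|w| ^+ 2 + 0.
    apply: cvgD; last exact: cvg_harmonic.
    apply: cvgD; last exact: cvg_cst.
    apply: cvgMl_tmp; apply: cvgB; last exact: cvg_cst.
    exact: cvg_weak_cvg.
  rewrite -[leRHS]addr0; apply: (cvgr_to_ge cvgl); apply: nearW => n.
  have := Fm _ (linear_subspaceD VL (Vv n) (linear_subspaceZ t VL Vw)).
  have := (v_min n).2.
  by rewrite /F sqr_normDZ phiD ?phiZ//; [lra|exact: linear_subspaceZ].
(* This [t] is close to the minimum of the polynomial in [var]; adding [1] to
   [|w|^2] avoids a separate case [w = 0]. *)
apply/eqP; rewrite -subr_eq0; set s := inner p w - phi w in var *.
have w0 : 0 < `|w| ^+ 2 + 1 by rewrite ltr_wpDl// exprn_ge0.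
have := var (- s / (`|w| ^+ 2 + 1)).
have -> : 2 * (- s / (`|w| ^+ 2 + 1)) * s +
    (- s / (`|w| ^+ 2 + 1)) ^+ 2 * `|w| ^+ 2 =
    - (s ^+ 2 * (`|w| ^+ 2 + 2) / (`|w| ^+ 2 + 1) ^+ 2).
  by field; rewrite gt_eqF.
rewrite oppr_ge0 pmulr_lle0 ?invr_gt0 ?exprn_gt0//.
rewrite pmulr_lle0 ?ltr_wpDl ?exprn_ge0//.
by move=> s0; rewrite -sqrf_eq0 eq_le s0 sqr_ge0.
Qed.

End riesz.

(** * Weak sequential compactness *)

Section weak_compactness.
Variable R : realType.

Lemma increasing_ge_id (k : nat -> nat) :
  {homo k : m n / (m < n)%N} -> forall n, (n <= k n)%N.
Proof. by move=> kS; elim=> // n IHn; rewrite (leq_ltn_trans IHn)// kS. Qed.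

Lemma cvg_subsequence (T : topologicalType) (x_ : nat -> T) (x : T)
    (k : nat -> nat) : {homo k : m n / (m < n)%N} ->
  x_ @ \oo --> x -> (x_ \o k) @ \oo --> x.
Proof.
move=> kS; apply: cvg_comp => A [N _ NA]; exists N => // n /= Nn.
exact/NA/(leq_trans Nn)/increasing_ge_id.
Qed.

Import ArrowAsProduct.

(** The rows [a n] lie in a product of segments, which is compact by Tychonoff's
theorem, so they have a cluster point [l]. Indices can then be picked one after
the other: the neighbourhoods of [l] that constrain the first [n] coordinates
suffice to force convergence in each coordinate. *)
Lemma diagonal_subsequence (a : nat -> nat -> R) (M : nat -> R) :
  (forall n m, `|a n m| <= M m) ->
  exists2 k : nat -> nat, {homo k : m n / (m < n)%N} &
    forall m, cvgn (fun n => a (k n) m).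
Proof.
move=> aM; pose K m := `[- M m, M m]%classic.
have [|l [_ l_cluster]] :=
    @tychonoff nat (fun=> R) K (fun=> @segment_compact _ _ _) (a @ \oo) _.
  by exists 0%N => // n _ m; rewrite /K/= in_itv/= -ler_norml.
have /choice[s s_step] (Nj : nat * nat) : exists i, (Nj.2 < i)%N /\
    forall m : 'I_Nj.1, `|l m - a i m| < harmonic Nj.1.
  case: Nj => N j.
  have tail_j : (a @ \oo) (a @` [set i | (j < i)%N]).
    by exists j.+1 => // i ji; exists i.
  pose B (m : 'I_N) : set (prod_topology (fun _ : nat => R)) :=
    [set f | `|l m - f m| < harmonic N].
  have ball_l : nbhs (l : prod_topology (fun=> R)) [set f | forall m, B m f].
    apply: (@filter_forall _ _ B _ (nbhs_filter _)) => m.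
    have := @proj_continuous nat (fun=> R) m l _
      (nbhsx_ballx (l m) (harmonic N) (harmonic_gt0 N)).
    by rewrite -ball_normE.
  have [_ [[i ji <-] il]] := l_cluster _ _ tail_j ball_l.
  by exists i.
pose k := fix k n := if n is p.+1 then s (p.+1, k p) else s (0, 0)%N.
have k_near n (m : 'I_n) : `|l m - a (k n) m| < harmonic n.
  by case: n m => [[]//|n] m; exact: (s_step (n.+1, k n)).2.
exists k.
  by apply: homo_ltn ltn_trans _ => n; exact: (s_step (n.+1, k n)).1.
move=> m; apply/cvg_ex; exists (l m); apply/cvgrPdist_lt => e e0.
near=> n; have mn : (m < n)%N by near: n; exists m.+1.
apply: lt_trans (k_near n (Ordinal mn)) _; near: n.
exact: (cvgr_lt (0 : R) cvg_harmonic).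
Unshelve. all: by end_near. Qed.

Variable H : hilbertType R.

(** The subsequence is chosen so that its inner products with the members of the
sequence itself converge; this replaces a countable dense set, so the space need
not be separable. *)
Theorem bounded_weak_subsequence (x_ : nat -> H) (M : R) :
  (forall n, `|x_ n| <= M) ->
  exists2 k : nat -> nat, {homo k : m n / (m < n)%N} &
    exists x, weak_cvg inner (x_ \o k) x.
Proof.
move=> xM.
have M0 : 0 <= M := le_trans (normr_ge0 _) (xM 0%N).
have [|k kS x_k] := @diagonal_subsequence
    (fun n m => inner (x_ n) (x_ m)) (fun m => M * `|x_ m|).
  by move=> n m; rewrite (le_trans (cauchy_schwarz _ _))// ler_wpM2r.
exists k => //.
pose V := [set y : H | cvgn (fun n => inner (x_ (k n)) y)].
pose ell y := limn (fun n => inner (x_ (k n)) y).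
have V_ell y : V y -> (fun n => inner (x_ (k n)) y) @ \oo --> ell y by [].
have V_lin a y z : V y -> V z ->
    (fun n => inner (x_ (k n)) (a *: y + z)) @ \oo --> a * ell y + ell z.
  move=> Vy Vz; under eq_fun do rewrite innerDr innerZr.
  by apply: cvgD (V_ell _ Vz); exact: cvgMl_tmp (V_ell _ Vy).
have VL : is_linear_subspace V.
  split.
    rewrite /V/=; under eq_fun do rewrite innerC inner0l.
    exact: is_cvg_cst.
  by move=> a y z Vy Vz; apply/cvg_ex; eexists; exact: V_lin.
have Vcl : closed V.
  move=> y clVy; apply: cauchy_cvg; apply: cauchy_exP => e e0.
  have M1 : 0 < M + 1 by rewrite ltr_wpDl.
  have e2 : 0 < e / 2 by rewrite divr_gt0.
  have [v [Vv /=]] := clVy _ (nbhsx_ballx y _ (divr_gt0 e2 M1)).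
  rewrite -ball_normE/= => yv; exists (ell v).
  move/cvgrPdist_lt : (V_ell _ Vv) => /(_ _ e2) nearv.
  near=> n; rewrite /= -ball_normE/=.
  rewrite -(subrKA (inner (x_ (k n)) v)) (le_lt_trans (ler_normD _ _))//.
  rewrite [e]splitr ltr_leD//; first by near: n.
  rewrite -innerBr (le_trans (cauchy_schwarz _ _))// distrC.
  rewrite -(divfK (lt0r_neq0 M1) (e / 2)) mulrC ler_pM ?(ltW yv)//.
  by rewrite (le_trans (xM _))// lerDl.
have [p Vp pE] : exists2 p, V p & forall v, V v -> inner p v = ell v.
  apply: (@riesz_closed_subspace _ _ _ ell M VL Vcl).
    by move=> a v w Vv Vw; apply: cvg_lim => //; exact: V_lin.
  move=> v Vv.
  apply: (cvgr_to_le (cvg_norm (V_ell _ Vv))); apply: nearW => n.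
  by rewrite (le_trans (cauchy_schwarz _ _))// ler_wpM2r.
exists p => y.
(* [y'] is the orthogonal projection of [y] on [V]. *)
have [y' Vy' y'E] : exists2 y', V y' & forall v, V v -> inner y' v = inner y v.
  apply: (@riesz_closed_subspace _ _ _ _ `|y| VL Vcl).
    by move=> a v w _ _; rewrite innerDr innerZr.
  by move=> v _; exact: cauchy_schwarz.
have swap v : V v -> inner v y = inner v y'.
  by move=> Vv; rewrite !(innerC v) y'E.
rewrite swap// (_ : (fun n => _) = (fun n => inner (x_ (k n)) y')).
  by rewrite pE//; exact: V_ell.
by apply/funext => n; apply: swap; exact: x_k.
Unshelve. all: by end_near. Qed.

End weak_compactness.

Lemma weak_cvg_pair (R : realType) (X Z : hilbertType R)
    (x_ : nat -> X) (z_ : nat -> Z) (x : X) (z : Z) :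
  weak_cvg inner x_ x -> weak_cvg inner z_ z ->
  weak_cvg (@inner_prod R X Z) (fun n => (x_ n, z_ n)) (x, z).
Proof. by move=> xx zz y; apply: cvgD; [exact: xx|exact: zz]. Qed.

Lemma weak_cvg_subsequence (R : realType) (H : hilbertType R)
    (x_ : nat -> H) (x : H) (k : nat -> nat) :
  {homo k : m n / (m < n)%N} -> weak_cvg inner x_ x ->
  weak_cvg inner (x_ \o k) x.
Proof. by move=> kS xx y; exact: cvg_subsequence kS (xx y). Qed.

(** * Norm limits, lower limits and the rate of the data error *)

Lemma limn_einf_le_cvg (R : realType) (a b : nat -> \bar R) (l : \bar R) :
  (forall n, a n <= b n)%E -> b @ \oo --> l -> (limn_einf a <= l)%E.
Proof.
move=> ab bl; rewrite limn_einf_lim -(cvg_lim _ bl)//.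
apply: lee_lim; [exact: is_cvg_einfs|by apply/cvg_ex; exists l|].
apply: nearW => n; apply: le_trans (ab n).
by apply: ereal_inf_lbound; exists n => /=.
Qed.

(** Squared norms, because the misfit and the data error are sums of squares, each
term of which is bounded by the whole. *)
Lemma cvg_sqr_dist (R : realType) (V : normedModType R) (x_ y_ : nat -> V)
    (y : V) (b : nat -> R) :
  (forall n, `|x_ n - y_ n| ^+ 2 <= b n) -> b @ \oo --> (0 : R) ->
  y_ @ \oo --> y -> x_ @ \oo --> y.
Proof.
move=> xb b0 yy; have -> : x_ = (fun n => (x_ n - y_ n) + y_ n).
  by apply/funext => n; rewrite subrK.
rewrite -[X in _ --> X]add0r; apply: cvgD yy.
apply/cvgr0Pnorm_lt => e e0; near=> n.
rewrite -ltr_sqr ?nnegrE ?(ltW e0)// (le_lt_trans (xb n))//; near: n.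
by apply: (cvgr_lt _ b0); rewrite exprn_gt0.
Unshelve. all: by end_near. Qed.

Lemma cvg_seq_norm_bounded (R : realType) (V : normedModType R)
  (x_ : nat -> V) : cvgn x_ -> exists M, forall n, `|x_ n| <= M.
Proof.
by move=> /cvg_seq_bounded/pinfty_ex_gt0[M _ xM]; exists M => n; exact: xM.
Qed.

Lemma littleo_at_right_ratio (R : realType) (h : R -> R) (a_ : nat -> R) :
  (h : R -> R^o) =o_ (0^'+) (fun a : R => a : R^o) ->
  (forall n, 0 < a_ n) -> a_ @ \oo --> (0 : R) ->
  (fun n => h (a_ n) / a_ n) @ \oo --> (0 : R).
Proof.
move=> ho a_gt0 a_0.
have : (fun a => h a / a) @ 0^'+ --> (0 : R).
  apply/cvgr0Pnorm_le => e e0; near=> a.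
  have a0 : 0 < a by [].
  rewrite normrM normfV ler_pdivrMr ?normr_gt0 ?gt_eqF//; near: a.
  by move/eqoP : ho; apply.
by move/cvg_at_rightP; apply.
Unshelve. all: by end_near. Qed.

(** * Convergence of Tikhonov minimizers *)

(** Since the functional is finite at an exact solution, it is finite at a
minimizer, which is therefore admissible; the inequality compares the two
values, the misfit of an exact solution being the data error. Passing to [fine]
is harmless because both values of [psi] are finite. *)
Lemma tikhonov_minimizer_le (R : realType) (X Y Z : hilbertType R)
    (domL : set X) (L : X -> Z -> X) (C : X -> Y) (psi : Z -> \bar R)
    (a : R) (g gbar : X) (f fbar : Y) (u v : X) (q r : Z) :
  (forall s, (0 <= psi s)%E) ->
  minimizer (tikhonov domL L C psi a g f) u q ->
  solution domL L C psi gbar fbar v r ->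
  [/\ domL u, (psi q < +oo)%E &
      `|L u q - g| ^+ 2 + `|C u - f| ^+ 2 + a * fine (psi q) <=
      `|g - gbar| ^+ 2 + `|f - fbar| ^+ 2 + a * fine (psi r)].
Proof.
move=> psi_ge0 /(_ v r) + [Dv psir Lv Cv]; rewrite /tikhonov.
have finE s : (psi s < +oo)%E -> psi s = (fine (psi s))%:E.
  by move=> ps; rewrite fineK// ge0_fin_numE.
case: asboolP => [[Du psiq]|_].
  rewrite (asboolT (conj Dv psir)) Lv Cv (finE _ psiq) (finE _ psir).
  rewrite -!EFinM -!EFinD lee_fin (distrC gbar) (distrC fbar) => le_J.
  by split; rewrite ?ltry.
rewrite (asboolT (conj Dv psir)) (finE _ psir) leye_eq.
by rewrite -EFinM -EFinD.
Qed.

Theorem theorem2 (R : realType) (X Y Z : hilbertType R)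
  (domL : set X) (DL : set (X * Z)) (L : X -> Z -> X)
  (DC : set X) (C : X -> Y) (psi : Z -> \bar R)
  (domL_subspace : is_linear_subspace domL)
  (L_bilinear : bilinear_on DL L)
  (psi_proper : proper_functional psi)
  (A1 : assumption_A1 psi)
  (A2 : forall c0 : R, assumption_A2 domL DL L DC psi c0)
  (A3 : assumption_A3 domL DL L DC C)
  (gbar : X) (fbar : Y)
  (exact_data : exists u q, solution domL L C psi gbar fbar u q)
  (g : R -> X) (f : R -> Y)
  (noise : (fun a : R => `|g a - gbar| ^+ 2 + `|f a - fbar| ^+ 2 : R^o)
             =o_ (0^'+) (fun a : R => a : R^o))
  (alpha : nat -> R) (alpha_gt0 : forall n, 0 < alpha n)
  (alpha_cvg0 : alpha @ \oo --> (0 : R))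
  (u : nat -> X) (q : nat -> Z)
  (uq_min : forall n,
     minimizer (tikhonov domL L C psi (alpha n) (g (alpha n)) (f (alpha n)))
       (u n) (q n)) :
  exists2 k : nat -> nat, {homo k : m n / (m < n)%N} &
  exists uhat qhat,
    weak_cvg (@inner_prod R X Z) (fun n => (u (k n), q (k n))) (uhat, qhat) /\
    min_norm_solution domL L C psi gbar fbar uhat qhat.
Proof.
have [_ psi_lsc [c c_gt0 psi_c]] := A1.
have psi_ge0 r : (0 <= psi r)%E.
  by apply: le_trans (psi_c r); rewrite lee_fin mulr_ge0 ?exprn_ge0// ltW.
pose delta (a : R) := `|g a - gbar| ^+ 2 + `|f a - fbar| ^+ 2.
have ratio0 : (fun n => delta (alpha n) / alpha n) @ \oo --> (0 : R).
  exact: littleo_at_right_ratio.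
have delta0 : (fun n => delta (alpha n)) @ \oo --> (0 : R).
  rewrite (_ : (fun n => _) = fun n => delta (alpha n) / alpha n * alpha n).
    by rewrite -(mulr0 (0 : R)); exact: cvgM.
  by apply/funext => n; rewrite divfK ?gt_eqF.
have le_sol n v r := @tikhonov_minimizer_le _ _ _ _ _ _ _ _ _
  _ gbar _ fbar _ v _ r psi_ge0 (uq_min n).
have [ubar [qbar sol_bar]] := exact_data.
have uDom n : domL (u n) by have [] := le_sol n _ _ sol_bar.
have psi_fin n : psi (q n) = (fine (psi (q n)))%:E.
  by have [_ ? _] := le_sol n _ _ sol_bar; rewrite fineK// ge0_fin_numE.
(* The term [delta / alpha] is where the rate [o(alpha)] is needed. *)
have psi_le v r n : solution domL L C psi gbar fbar v r ->
    fine (psi (q n)) <= delta (alpha n) / alpha n + fine (psi r).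
  move=> /(le_sol n)[_ _ le_n].
  rewrite -(ler_pM2r (alpha_gt0 n)) mulrDl divfK ?gt_eqF//.
  rewrite ![_ * alpha n]mulrC; apply: le_trans le_n.
  by rewrite lerDr addr_ge0 ?sqr_ge0.
have [M ratioM] : exists M, forall n, `|delta (alpha n) / alpha n| <= M.
  by apply: cvg_seq_norm_bounded; apply/cvg_ex; exists 0.
pose lev := M + fine (psi qbar).
have qlevel n : level_set psi lev (q n).
  rewrite /level_set/= psi_fin lee_fin (le_trans (psi_le _ _ _ sol_bar))//.
  by rewrite lerD2r (le_trans (ler_norm _)).
have [dom_incl _ [c1 c1_gt0 coer] _] := A2 lev.
pose E n := delta (alpha n) + alpha n * fine (psi qbar).
have E0 : E @ \oo --> (0 : R).
  rewrite -[X in _ --> X](addr0 (0 : R)); apply: cvgD => //.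
  by rewrite -(mul0r (fine (psi qbar))); exact: cvgMr_tmp.
have misfit n : `|L (u n) (q n) - g (alpha n)| ^+ 2 +
    `|C (u n) - f (alpha n)| ^+ 2 <= E n.
  have [_ _ le_n] := le_sol n _ _ sol_bar.
  apply: le_trans le_n; rewrite lerDl mulr_ge0 ?(ltW (alpha_gt0 n))//.
  exact: fine_ge0.
have L_cvg : (fun n => L (u n) (q n)) @ \oo --> gbar.
  apply: (@cvg_sqr_dist _ _ _ (g \o alpha) _ _ _ E0) => [n|].
    by apply: le_trans (misfit n); rewrite lerDl sqr_ge0.
  apply: (@cvg_sqr_dist _ _ _ (cst gbar) _ _ _ delta0 (cvg_cst _)) => n.
  by rewrite /delta lerDl sqr_ge0.
have C_cvg : (fun n => C (u n)) @ \oo --> fbar.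
  apply: (@cvg_sqr_dist _ _ _ (f \o alpha) _ _ _ E0) => [n|].
    by apply: le_trans (misfit n); rewrite lerDr sqr_ge0.
  apply: (@cvg_sqr_dist _ _ _ (cst fbar) _ _ _ delta0 (cvg_cst _)) => n.
  by rewrite /delta lerDr sqr_ge0.
have [|k1 k1S [qhat q_qhat]] :=
    @bounded_weak_subsequence _ _ q (Num.sqrt (lev / c)).
  move=> n; rewrite -[`|q n|]normr_id -sqrtr_sqr ler_wsqrtr//.
  rewrite ler_pdivlMr// mulrC -lee_fin (le_trans (psi_c _))//.
  exact: qlevel.
have [B LB] : exists B, forall n, `|L (u n) (q n)| <= B.
  by apply: cvg_seq_norm_bounded; apply/cvg_ex; exists gbar.
have [|k2 k2S [uhat u_uhat]] :=
    @bounded_weak_subsequence _ _ (u \o k1) (B / c1).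
  move=> n; rewrite /= ler_pdivlMr// mulrC.
  exact: le_trans (coer _ _ (uDom _) (qlevel _)) (LB _).
pose k := k1 \o k2.
have kS : {homo k : m n / (m < n)%N} by move=> m n /k2S/k1S.
have qk : weak_cvg inner (q \o k) qhat := weak_cvg_subsequence k2S q_qhat.
exists k => //; exists uhat, qhat.
have p_cvg := weak_cvg_pair u_uhat qk.
split; first exact: p_cvg.
have p_dom n : domLC domL DL DC (u (k n), q (k n)).
  have [] := dom_incl _ (uDom (k n)) _ (qlevel (k n)).
  by split; first exact: uDom.
have [[uhatD _ _] L_weak C_weak] := A3 _ _ p_dom p_cvg.
have psi_hat v r : solution domL L C psi gbar fbar v r -> (psi qhat <= psi r)%E.
  move=> sol_r; apply: le_trans (psi_lsc _ _ qk) _.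
  have psir : psi r = (fine (psi r))%:E.
    by case: sol_r => _ ? _ _; rewrite fineK// ge0_fin_numE.
  apply: (@limn_einf_le_cvg _ _
    (fun n => (delta (alpha (k n)) / alpha (k n) + fine (psi r))%:E)).
    by move=> n /=; rewrite psi_fin lee_fin; exact: psi_le sol_r.
  rewrite psir -[X in _ --> X%:E]add0r; apply: cvg_EFin; first exact: nearW.
  apply: cvgD; last exact: cvg_cst.
  exact: (cvg_subsequence kS ratio0).
split=> //; split=> //.
- by apply: le_lt_trans (psi_hat _ _ sol_bar) _; case: sol_bar.
- exact: weak_cvg_unique L_weak (cvg_weak_cvg (cvg_subsequence kS L_cvg)).
- exact: weak_cvg_unique C_weak (cvg_weak_cvg (cvg_subsequence kS C_cvg)).
Qed.
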